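(* Let $\Omega\subset D=[0,1]^n$ be a bounded domain, let $\mathcal{D}$ be a direction set, and let $g:\mathbb{R}^n\to\mathbb{R}$ be continuous. Assume there exists a continuous function $g_0:\mathbb{R}^n\to\mathbb{R}$ which is $\mathcal{D}$-convex on $\mathbb{R}^n$, with $g\ge g_0$ in $\Omega$ and $g=g_0$ on $D\setminus\Omega$. Let $u\in USC(\Omega)$ be a viscosity subsolution and $v\in LSC(\Omega)$ a viscosity supersolution of $$\max\{u(x)-g(x),\,-\lambda_{\mathcal{D}}(D^2u(x))\}=0\quad\text{in }\Omega.$$ If $u\le v$ on $\partial\Omega$, then $u\le v$ on $\Omega$.
   Context: A set $\mathcal{D}\subset\mathbb{R}^n$ is a direction set if its span is $\mathbb{R}^n$, it is symmetric ($d\in\mathcal{D}\Rightarrow -d\in\mathcal{D}$), and $0\notin\mathcal{D}$. A continuous $u:\mathbb{R}^n\to\mathbb{R}$ is $\mathcal{D}$-convex if $u(\lambda x+(1-\lambda)y)\le\lambda u(x)+(1-\lambda)u(y)$ for all $\lambda\in[0,1]$ and all $x,y$ with $x-y\in\mathcal{D}$. For a symmetric matrix $M$, $\lambda_{\mathcal{D}}(M)=\inf_{v\in\mathcal{D}}\frac{v^\intercal M v}{|v|^2}$. An upper semicontinuous $u$ is a viscosity subsolution of the equation if for every $C^2$ function $\phi$ and every point $x\in\Omega$ at which $u-\phi$ has a local maximum, $u(x)-g(x)\le 0$ and $-\lambda_{\mathcal{D}}(D^2\phi(x))\le 0$. A lower semicontinuous $u$ is a viscosity supersolution if for every $C^2$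 function $\phi$ and every $x\in\Omega$ at which $u-\phi$ has a local minimum, $u(x)-g(x)\ge0$ or $-\lambda_{\mathcal{D}}(D^2\phi(x))\ge0$. $USC$ and $LSC$ denote upper and lower semicontinuous functions.
   Formalization: The functions u and v are taken to be defined and upper, respectively lower, semicontinuous on the closure of Ω rather than only on Ω; otherwise the condition u ≤ v on ∂Ω is undefined, or the claim fails for boundary values unrelated to the interior ones. *)

(* Defs.v *)
From HB Require Import structures.
From mathcomp Require Import all_boot all_order all_algebra.
From mathcomp Require Import all_classical all_reals all_analysis.
Set Implicit Arguments. Unset Strict Implicit. Unset Printing Implicit Defensive.
Import Order.TTheory GRing.Theory Num.Theory.
Import numFieldNormedType.Exports.
Local Open Scope classical_set_scope.
Local Open Scope ring_scope.

Section Defs.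
Variables (R : realType) (n : nat).
Implicit Types (x y v w : 'rV[R]_n) (A Dset : set 'rV[R]_n).

Definition eucl_sq v : R := \sum_(i < n) (v 0 i) ^+ 2.

Definition qform (M : 'M[R]_n) v : R := (v *m M *m v^T) 0 0.

Definition spans_all Dset := forall w, exists (k : nat) (c : 'I_k -> R)
  (d : 'I_k -> 'rV[R]_n), (forall i, Dset (d i)) /\ w = \sum_(i < k) c i *: d i.

Definition direction_set Dset :=
  [/\ spans_all Dset, (forall d, Dset d -> Dset (- d)) & ~ Dset 0].

Definition D_convex Dset (u : 'rV[R]_n -> R) :=
  forall (l : R) x y, 0 <= l <= 1 -> Dset (x - y) ->
    u (l *: x + (1 - l) *: y) <= l * u x + (1 - l) * u y.

Definition lambdaD Dset (M : 'M[R]_n) : \bar R :=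
  ereal_inf [set ((qform M v / eucl_sq v)%:E) | v in Dset].

Definition partial (i : 'I_n) (f : 'rV[R]_n -> R) : 'rV[R]_n -> R :=
  fun x => 'D_(delta_mx 0 i) f x.

Definition partial_ex (i : 'I_n) (f : 'rV[R]_n -> R) : Prop :=
  forall x, derivable f x (delta_mx 0 i).

Definition C2 (f : 'rV[R]_n -> R) : Prop :=
  continuous f /\
  forall i, partial_ex i f /\ continuous (partial i f) /\
    forall j, partial_ex j (partial i f) /\ continuous (partial j (partial i f)).

Definition hessian (f : 'rV[R]_n -> R) x : 'M[R]_n :=
  \matrix_(i, j) partial i (partial j f) x.

Definition local_max (f : 'rV[R]_n -> R) x := \forall y \near x, f y <= f x.
Definition local_min (f : 'rV[R]_n -> R) x := \forall y \near x, f x <= f y.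

Definition usc_on A (u : 'rV[R]_n -> R) := forall x, A x ->
  forall e : R, 0 < e -> \forall y \near x, A y -> u y < u x + e.
Definition lsc_on A (u : 'rV[R]_n -> R) := forall x, A x ->
  forall e : R, 0 < e -> \forall y \near x, A y -> u x - e < u y.

(* viscosity sub/supersolution of max{u-g, -lambda_D(D^2u)} = 0 in Omega *)
Definition visc_sub Dset (g : 'rV[R]_n -> R) Omega (u : 'rV[R]_n -> R) :=
  forall phi x, C2 phi -> Omega x -> local_max (fun y => u y - phi y) x ->
    u x - g x <= 0 /\ (- lambdaD Dset (hessian phi x) <= 0)%E.

Definition visc_super Dset (g : 'rV[R]_n -> R) Omega (u : 'rV[R]_n -> R) :=
  forall phi x, C2 phi -> Omega x -> local_min (fun y => u y - phi y) x ->
    u x - g x >= 0 \/ (- lambdaD Dset (hessian phi x) >= 0)%E.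

Definition unit_cube : set 'rV[R]_n := [set x | forall i, 0 <= x 0 i <= 1].

Definition bounded_domain Omega :=
  [/\ open Omega, connected Omega, Omega !=set0 &
      exists M : R, forall x, Omega x -> forall i, `|x 0 i| <= M].

End Defs.

(* Main.v *)
(* The obstacle condition [u <= g] and convexity of [u] along the directions of
   [Dset] both follow from the subsolution property by testing with quadratics.
   Directional convexity is linear and translation invariant, so it survives
   sup-convolution (which makes [u] Lipschitz) and averaging along the coordinate
   axes (which makes it C2). Adding [eps |x|^2] to the smoothed [u] gives a C2
   function whose Hessian is positive along [Dset], by at least [2 eps]. If [u > v]
   somewhere, this function touches [v] from below at a point of Omega where
   [v < g], which contradicts the supersolution property. Since the smooth function
   is itself the test function, no theorem on sums is needed. *)
Require Import Defs.
From HB Require Import structures.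
From mathcomp Require Import all_boot all_order all_algebra.
From mathcomp Require Import all_classical all_reals all_analysis.
From mathcomp Require Import ring lra.
Import Order.TTheory GRing.Theory Num.Theory.
Import numFieldNormedType.Exports.
Local Open Scope classical_set_scope.
Local Open Scope ring_scope.
Set Implicit Arguments. Unset Strict Implicit. Unset Printing Implicit Defensive.

(** The domain is the obstacle. Convexity of [u] is known only where a ball around the segment lies
    in [Omega], and each regularisation costs a ball of its own radius, so a margin must be secured
    before anything is regularised. It comes from the boundary condition: by compactness and
    semicontinuity, the gap [m] fixes a radius [r] such that a point where [v] lies well below a
    value of [u] taken within [r] of it keeps its [r]-ball inside [Omega]. Only then are the
    Lipschitz constant [L], the averaging width [d] and [eps] chosen. The penalty of the
    sup-convolution is linear: as [u] is bounded, a large [L] rules out distant competitors, and the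
    global Lipschitz bound makes the averaging error a multiple of [L * d]. An average along an axis
    has a difference quotient as its derivative, so each one gains a derivative along that axis, and
    the one-dimensional fundamental theorem of calculus suffices. Convexity stays in midpoint form,
    free of derivatives, until the Hessian exists. *)

Section Derivative.
Variable R : realType.

Lemma scaleRE (x y : R) : x *: y = x * y.
Proof. by []. Qed.

(** Free of division and valid at [h = 0], this form lets explicit error bounds be added and
    composed without handling the punctured filter. *)
Lemma is_derive_epsP (V : normedModType R) (f : V -> R) (x v : V) (l : R) :
  is_derive x v f l <-> forall e : R, 0 < e -> exists2 d : R, 0 < d &
    forall h, `|h| < d -> `|f (x + h *: v) - f x - h * l| <= e * `|h|.
Proof.
split=> [dfl e e0|fl].
- have : (fun h => h^-1 *: ((f \o shift x) (h *: v) - f x)) @ 0^' --> l.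
    by rewrite -(@derive_val _ _ _ _ _ _ _ dfl); exact: ex_derive.
  move=> /cvgrPdist_le/(_ _ e0); rewrite near_withinE => /nbhs_ballP[d /= d0 dP].
  exists d => // h hd; have [->|h0] := eqVneq h 0.
    by rewrite scale0r addr0 subrr mul0r subr0 normr0 mulr0.
  have := dP h; rewrite /ball /= sub0r normrN => /(_ hd h0).
  rewrite (addrC (h *: v)) => H.
  have -> : f (x + h *: v) - f x - h * l =
      - ((l - h^-1 *: (f (x + h *: v) - f x)) * h).
    by rewrite scaleRE; field.
  by rewrite normrN normrM ler_wpM2r.
- have c : (fun h => h^-1 *: ((f \o shift x) (h *: v) - f x)) @ 0^' --> l.
    apply/cvgrPdist_le => e e0; have [d d0 dP] := fl _ e0.
    rewrite near_withinE; apply/nbhs_ballP; exists d => //= h.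
    rewrite /ball /= sub0r normrN => /dP + h0.
    rewrite (addrC (h *: v)) => H.
    have -> : l - h^-1 *: (f (x + h *: v) - f x) =
      - ((f (x + h *: v) - f x - h * l) / h).
      by rewrite scaleRE; field.
    by rewrite normrN normf_div ler_pdivrMr// normr_gt0.
  by split; [apply/cvg_ex; exists l | exact/cvg_lim].
Qed.

Lemma is_derive_line (V : normedModType R) (f : V -> R) (x v : V) (t l : R) :
  is_derive (x + t *: v) v f l <-> is_derive t 1 (fun s => f (x + s *: v)) l.
Proof.
have E h : x + (t + h *: 1) *: v = x + t *: v + h *: v.
  by rewrite scalerDl addrA [h *: 1]mulr1.
by rewrite !is_derive_epsP; split=> H e /H[d d0 dP]; exists d => // h /dP; rewrite E.
Qed.

Lemma is_derive_within_continuous (f df : R -> R) (a b : R) :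
  (forall t, t \in `[a, b] -> is_derive t 1 f (df t)) ->
  {within `[a, b], continuous f}.
Proof. by move=> H; apply: derivable_within_continuous => t /H ?; exact: ex_derive. Qed.

Lemma MVT_line (V : normedModType R) (f df : V -> R) (x v : V) (t : R) :
  (forall y, is_derive y v f (df y)) ->
  exists2 c : R, `|c| <= `|t| & f (x + t *: v) - f x = t * df (x + c *: v).
Proof.
move=> fv.
pose p (s : R) := f (x + s *: v); pose q (s : R) := df (x + s *: v).
have H (s : R) : is_derive s 1 p (q s) := (is_derive_line f x v s _).1 (fv _).
have cp a b : {within `[a, b], continuous p}.
  by apply: (@is_derive_within_continuous _ q) => s _; exact: H.
have p0 : p 0 = f x by rewrite /p scale0r addr0.
have [t0|t0] := leP 0 t.
- have [c] := @MVT_segment R p q 0 t t0 (fun s _ => H s) (cp _ _).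
  rewrite in_itv/= => /andP[c0 ct]; rewrite p0 subr0 mulrC => E.
  by exists c; [rewrite !ger0_norm | exact: E].
- have [c] := @MVT_segment R p q t 0 (ltW t0) (fun s _ => H s) (cp _ _).
  rewrite in_itv/= => /andP[c0 ct]; rewrite p0 sub0r mulrN mulrC => E.
  exists c; first by rewrite !ler0_norm ?lerN2// ltW.
  by rewrite -(opprB (f x)) [f x - _]E opprK.
Qed.

End Derivative.

(** * Means of continuous functions over a symmetric interval *)

Section Average.
Variable R : realType.
Implicit Types (d t s : R) (h P : R -> R).

Lemma primitive_near_segment h d : continuous h -> exists P : R -> R,
  forall t, `|t| < d -> is_derive t 1 P (h t).
Proof.
move=> ch; exists (fun x => Rintegral lebesgue_measure `[- d, x] h) => t td.
have /andP[td1 td2] : - d < t < d by rewrite -ltr_norml.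
have [|ex dE] := @continuous_FTC1_closed R h (- d) t d td2 _ td1 (ch t).
  apply: continuous_compact_integrable; first exact: segment_compact.
  exact: continuous_subspaceT.
rewrite derive1E in dE; exact: (DeriveDef ex dE).
Qed.

Lemma le_primitive h1 h2 P1 P2 (a b : R) : a <= b ->
  (forall t, a <= t <= b -> is_derive t 1 P1 (h1 t)) ->
  (forall t, a <= t <= b -> is_derive t 1 P2 (h2 t)) ->
  (forall t, a <= t <= b -> h1 t <= h2 t) ->
  P1 b - P1 a <= P2 b - P2 a.
Proof.
move=> ab p1 p2 h12.
pose q t := h2 t - h1 t.
have p t : t \in `[a, b] -> is_derive t 1 (P2 - P1) (q t).
  by rewrite in_itv/= => tab; apply: is_deriveB; [exact: p2|exact: p1].
have cp : {within `[a, b], continuous (P2 - P1)}.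
  exact: (@is_derive_within_continuous R _ q a b p).
have p' t : t \in `]a, b[ -> is_derive t 1 (P2 - P1) (q t).
  by rewrite in_itv/= => /andP[at_ tb]; apply: p; rewrite in_itv/= !ltW.
have [c] := @MVT_segment R (P2 - P1) q a b ab p' cp.
rewrite in_itv/= => /h12 hc.
have -> : (P2 - P1) b - (P2 - P1) a = (P2 b - P2 a) - (P1 b - P1 a).
  by rewrite !fctE; ring.
move=> E; rewrite -subr_ge0 E mulr_ge0// subr_ge0//.
Qed.

(* The mean of [h] over [[-d, d]], read off an arbitrary primitive of [h]; a junk
   value when [h] has no primitive. *)
Definition avg d h : R :=
  let P := xget h [set P | forall t : R, `|t| <= d -> is_derive t 1 P (h t)] in
  (P d - P (- d)) / (2 * d).

(** The increment does not depend on the primitive: [le_primitive] with the same integrand on both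
    sides gives both inequalities. *)
Lemma avgE d h P : 0 < d ->
  (forall t : R, `|t| <= d -> is_derive t 1 P (h t)) ->
  avg d h = (P d - P (- d)) / (2 * d).
Proof.
move=> d0 hP; rewrite /avg; case: xgetP => [Q _ hQ|/(_ P)//].
have dd : - d <= d by lra.
congr (_ / _); apply/eqP; rewrite eq_le.
by apply/andP; split; apply: (@le_primitive h h) => // t;
  rewrite -ler_norml; [apply: hQ|apply: hP|apply: hP|apply: hQ].
Qed.

Lemma avg_primitive d h : 0 < d -> continuous h -> exists2 P : R -> R,
  (forall t : R, `|t| < d + 1 -> is_derive t 1 P (h t)) &
  avg d h = (P d - P (- d)) / (2 * d).
Proof.
(* The primitive is differentiable only inside its open interval; the extra 1 makes the end points
   [d] and [- d] interior. *)
move=> d0 ch; have [P hP] := primitive_near_segment (d + 1) ch.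
by exists P => //; apply: avgE => // t td; apply: hP; lra.
Qed.

Lemma avg_le d h1 h2 : 0 < d -> continuous h1 -> continuous h2 ->
  (forall t, `|t| <= d -> h1 t <= h2 t) -> avg d h1 <= avg d h2.
Proof.
move=> d0 /(avg_primitive d0)[P1 p1 ->] /(avg_primitive d0)[P2 p2 ->] h12.
apply: ler_wpM2r; first by rewrite invr_ge0 mulr_ge0 ?ltW.
by apply: (@le_primitive h1 h2); first lra;
  move=> t; rewrite -ler_norml => td; [apply: p1|apply: p2|apply: h12] => //; lra.
Qed.

Lemma avg_lin d (a b : R) h1 h2 : 0 < d -> continuous h1 -> continuous h2 ->
  avg d (fun t => a * h1 t + b * h2 t) = a * avg d h1 + b * avg d h2.
Proof.
move=> d0 /(avg_primitive d0)[P1 p1 ->] /(avg_primitive d0)[P2 p2 ->].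
have H t : `|t| <= d ->
    is_derive t 1 (fun t => a * P1 t + b * P2 t) (a * h1 t + b * h2 t).
  move=> td; have {}td : `|t| < d + 1 by lra.
  exact: (is_deriveD (is_deriveZ a (p1 _ td)) (is_deriveZ b (p2 _ td))).
by rewrite (avgE d0 H); field; lra.
Qed.

Lemma avg_cst d (c : R) : 0 < d -> avg d (fun=> c) = c.
Proof.
move=> d0.
have H t : `|t| <= d -> is_derive t 1 ( *%R c) c.
  by move=> _; rewrite -[X in is_derive _ _ _ X]mulr1; exact: is_deriveZ.
by rewrite (avgE d0 H); field; lra.
Qed.

Lemma avg_dist d h (c e : R) : 0 < d -> continuous h ->
  (forall t, `|t| <= d -> `|h t - c| <= e) -> `|avg d h - c| <= e.
Proof.
move=> d0 ch hc; rewrite ler_distl.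
rewrite -(avg_cst (c - e) d0) -[X in _ && (_ <= X)](avg_cst (c + e) d0).
have cc (a : R) : continuous (fun _ : R => a) by move=> ?; exact: cvg_cst.
by apply/andP; split; apply: avg_le => // t /hc; rewrite ler_distl => /andP[].
Qed.

(** Shifting the integrand shifts the primitive, so only the derivatives of the primitive at the two
    ends enter. This is how averaging a merely continuous function gains one derivative. *)
Lemma avg_shift_derive d h : 0 < d -> continuous h ->
  is_derive (0 : R) 1 (fun s => avg d (fun t => h (t + s)))
    ((h d - h (- d)) / (2 * d)).
Proof.
move=> d0 ch; have [P hP] := primitive_near_segment (d + 1) ch.
have dP t : `|t| <= d -> is_derive t 1 P (h t) by move=> td; apply: hP; lra.
have /is_derive_epsP Pd : is_derive d 1 P (h d).
  by apply: dP; rewrite ger0_norm// ltW.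
have /is_derive_epsP PNd : is_derive (- d) 1 P (h (- d)).
  by apply: dP; rewrite normrN ger0_norm// ltW.
have sE s : `|s| < 1 ->
    avg d (fun t => h (t + s)) = (P (d + s) - P (- d + s)) / (2 * d).
  move=> s1; apply: (@avgE d (fun t => h (t + s)) (fun t => P (t + s))) => // t td.
  have ts : `|s + t| < d + 1 by rewrite (le_lt_trans (ler_normD _ _))//; lra.
  have := hP (s + t) ts.
  rewrite -[t in (s + t)](mulr1 t) => /(is_derive_line P s 1 t _).1.
  by under eq_fun do rewrite [_ *: 1]mulr1 addrC; rewrite mulr1 (addrC s).
apply/is_derive_epsP => e e0.
(* Two end point errors of [e * d * |s|], divided by [2 * d], give [e * |s|]. *)
have ed0 : 0 < e * d by rewrite mulr_gt0.
have [a a0 aP] := Pd _ ed0; have [b b0 bP] := PNd _ ed0.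
exists (Num.min 1 (Num.min a b)); first by rewrite !lt_min ltr01 a0 b0.
move=> s; rewrite !lt_min => /and3P[s1 sa sb].
have := aP s sa; have := bP s sb; rewrite [s *: 1]mulr1 => hb ha.
rewrite add0r (sE s)// (sE 0) ?normr0// !addr0.
rewrite (_ : _ - _ = ((P (d + s) - P d - s * h d) -
  (P (- d + s) - P (- d) - s * h (- d))) / (2 * d)); last by field; lra.
have d2 : 0 < 2 * d by lra.
rewrite normf_div (gtr0_norm d2) ler_pdivrMr// (le_trans (ler_normB _ _))//.
apply: (le_trans (lerD ha hb)); lra.
Qed.

End Average.

(** * Averaging along a direction: Lipschitz bounds, derivatives, convexity *)

Section Smoothing.
Variables (R : realType) (V : normedModType R).
Implicit Types (f df : V -> R) (x y e w : V) (L d t s r : R).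

Definition lip L f := 0 <= L /\ forall x y, `|f x - f y| <= L * `|x - y|.

Lemma lip_continuous L f : lip L f -> continuous f.
Proof.
move=> [L0 fL] x; apply/cvgrPdist_le => e e0.
have L1 : 0 < L + 1 by lra.
apply/nbhs_ballP; exists (e / (L + 1)) => /=; first by rewrite divr_gt0.
move=> y; rewrite -ball_normE /= => xy; apply: (le_trans (fL x y)).
rewrite (le_trans (_ : _ <= (L + 1) * `|x - y|)) ?ler_wpM2r//; first lra.
by rewrite mulrC -ler_pdivlMr// ltW.
Qed.

Lemma line_continuous f x w : continuous f -> continuous (fun t => f (x + t *: w)).
Proof.
move=> cf t; apply: (@continuous_comp _ _ _ (fun t => x + t *: w)); last exact: cf.
by apply: cvgD; [exact: cvg_cst|apply: cvgZr_tmp; exact: cvg_id].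
Qed.

Lemma lincomb_continuous (h1 h2 : R -> R) (a b : R) :
  continuous h1 -> continuous h2 -> continuous (fun t => a * h1 t + b * h2 t).
Proof.
move=> c1 c2 t; apply: cvgD; apply: cvgM; first exact: cvg_cst.
- exact: c1.
- exact: cvg_cst.
- exact: c2.
Qed.

Definition smear d e f x := avg d (fun t => f (x + t *: e)).

Definition dquo d e f x := (f (x + d *: e) - f (x - d *: e)) / (2 * d).

Section Smear.
Variables (d : R) (e : V).
Hypotheses (d0 : 0 < d) (e1 : `|e| <= 1).

Lemma normZ_le t : `|t| <= d -> `|t *: e| <= d.
Proof. by move=> td; rewrite normrZ -[leRHS]mulr1 ler_pM. Qed.

Lemma smear_lin f1 f2 x y (a b : R) : continuous f1 -> continuous f2 ->
  a * smear d e f1 x + b * smear d e f2 y =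
  avg d (fun t => a * f1 (x + t *: e) + b * f2 (y + t *: e)).
Proof. by move=> c1 c2; rewrite avg_lin//; exact: line_continuous. Qed.

Lemma lip_smear L f : lip L f -> lip L (smear d e f).
Proof.
move=> fL; have cf := lip_continuous fL; case: fL => L0 fL; split=> // x y.
rewrite -[smear d e f x]mul1r -[X in _ - X]mul1r -mulNr smear_lin//.
rewrite -[X in `|X|]subr0; apply: avg_dist => //.
  by apply: lincomb_continuous; exact: line_continuous.
move=> t _; rewrite subr0 mul1r mulN1r (le_trans (fL _ _))//.
by rewrite opprD addrACA subrr addr0.
Qed.

Lemma smear_dist L f x : lip L f -> `|smear d e f x - f x| <= L * d.
Proof.
move=> fL; have cf := lip_continuous fL; case: fL => L0 fL.
apply: avg_dist => //; first exact: line_continuous.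
move=> t td; rewrite (le_trans (fL _ _))// ler_wpM2l//.
by rewrite addrAC subrr add0r normZ_le.
Qed.

Lemma smear_derive_self f x : continuous f ->
  is_derive x e (smear d e f) (dquo d e f x).
Proof.
move=> cf; have := avg_shift_derive d0 (line_continuous (x := x) (w := e) cf).
rewrite (_ : (fun s => _) = (fun s => smear d e f (x + s *: e))); last first.
  apply: eq_fun => s; rewrite /smear; congr (avg d _).
  by apply: eq_fun => t; rewrite scalerDl addrA addrAC.
move=> H; have := (is_derive_line (smear d e f) x e 0 _).2 H.
by rewrite scale0r addr0 /dquo scaleNr.
Qed.

(** Differentiation under the average: the mean value theorem and the Lipschitz bound on [df]
    control the first-order error by [L * |w| * |h| ^+ 2], uniformly in the averaging variable. *)
Lemma smear_derive L f df x w : continuous f ->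
  (forall y, is_derive y w f (df y)) -> lip L df ->
  is_derive x w (smear d e f) (smear d e df x).
Proof.
move=> cf fdf dfL; have cdf := lip_continuous dfL; case: dfL => L0 dfL.
apply/is_derive_epsP => k k0.
have Lw1 : 0 < L * `|w| + 1 by rewrite ltr_wpDl// mulr_ge0.
exists (k / (L * `|w| + 1)); first by rewrite divr_gt0.
move=> h; rewrite ltr_pdivlMr// => hk.
rewrite -[smear d e f (x + _)]mul1r -[X in _ - X - _]mul1r -mulNr smear_lin//.
have c1 : continuous (fun t => 1 * f (x + h *: w + t *: e) + -1 * f (x + t *: e)).
  by apply: lincomb_continuous; exact: line_continuous.
rewrite -[X in X - _]mul1r -[- (h * _)]mulNr -avg_lin//; last first.
  exact: line_continuous.
rewrite -[X in `|X|]subr0; apply: avg_dist => //.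
  by apply: lincomb_continuous => //; exact: line_continuous.
move=> t _; rewrite subr0 !mul1r mulN1r mulNr.
have [c ch] := MVT_line (x + t *: e) h fdf.
rewrite (addrAC x) => ->.
rewrite -mulrBr normrM mulrC ler_wpM2r// (le_trans (dfL _ _))//.
rewrite addrAC subrr add0r normrZ.
rewrite (le_trans (_ : _ <= L * (`|h| * `|w|)))//.
  by rewrite ler_wpM2l// ler_wpM2r.
by move: hk; rewrite mulrDr mulr1 mulrCA => hk; have := normr_ge0 h; lra.
Qed.

Lemma lip_dquo L f : lip L f -> lip (L / d) (dquo d e f).
Proof.
move=> [L0 fL]; split=> [|x y]; first by rewrite divr_ge0// ltW.
rewrite /dquo -mulrBl normrM [X in _ * X]ger0_norm; last first.
  by rewrite invr_ge0 mulr_ge0// ltW.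
have H1 := fL (x + d *: e) (y + d *: e); have H2 := fL (x - d *: e) (y - d *: e).
have E1 z : x + z - (y + z) = x - y by rewrite opprD addrACA subrr addr0.
rewrite !E1 in H1, H2.
rewrite (_ : _ - _ = (f (x + d *: e) - f (y + d *: e)) -
  (f (x - d *: e) - f (y - d *: e))); last by ring.
rewrite ler_pdivrMr ?mulr_gt0// (le_trans (ler_normB _ _))//.
apply: (le_trans (lerD H1 H2)).
by rewrite (_ : _ / _ * _ * _ = L * `|x - y| + L * `|x - y|)//; field; rewrite gt_eqF.
Qed.

Lemma is_derive_shifted f (a x w : V) (l : R) :
  is_derive (x + a) w f l -> is_derive x w (fun y => f (y + a)) l.
Proof.
move=> /is_derive_epsP H; apply/is_derive_epsP => k /H[b b0 bP].
by exists b => // h /bP; rewrite (addrAC x).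
Qed.

Lemma dquo_derive f df x w : (forall y, is_derive y w f (df y)) ->
  is_derive x w (dquo d e f) (dquo d e df x).
Proof.
move=> fdf; rewrite /dquo.
have -> : (fun y => (f (y + d *: e) - f (y - d *: e)) / (2 * d)) =
  (2 * d)^-1 \*: ((fun y => f (y + d *: e)) - (fun y => f (y - d *: e))).
  by apply: eq_fun => y; rewrite mulrC.
rewrite [X in is_derive _ _ _ X]mulrC.
by apply: is_deriveZ; apply: is_deriveB; apply: is_derive_shifted.
Qed.

(* Midpoint convexity in direction [w] at those scales where the [r]-enlarged
   ball around the midpoint stays inside [U]. *)
Definition midconv (U : set V) r w f := forall x t,
  (forall z, `|z| <= r + `|t *: w| -> U (x + z)) ->
  2 * f x <= f (x + t *: w) + f (x - t *: w).

(** The average involves only translates of [f] by vectors of norm at most [d]; each satisfies the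
    inequality once the ball is enlarged by [d]. *)
Lemma midconv_smear U r w f : continuous f ->
  midconv U r w f -> midconv U (r + d) w (smear d e f).
Proof.
move=> cf fc x t xU.
rewrite -[leLHS]addr0 -[X in _ + X](mul0r (smear d e f x)) smear_lin//.
rewrite -[X in _ <= X + _]mul1r -[X in _ <= _ + X]mul1r smear_lin//.
apply: avg_le => //.
- by apply: lincomb_continuous; exact: line_continuous.
- by apply: lincomb_continuous; exact: line_continuous.
move=> s sd; rewrite mul0r addr0 !mul1r (addrAC x (t *: w)) (addrAC x (- (t *: w))).
apply: fc => z zr; rewrite -addrA; apply: xU.
rewrite (le_trans (ler_normD _ _))//; have := normZ_le sd; lra.
Qed.

End Smear.

(** * Two averages along each axis, and the regularity they produce *)

Section Iterate.
Variables (I : eqType) (E : I -> V) (d : R).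
Hypotheses (d0 : 0 < d) (E1 : forall i, `|E i| <= 1).
Implicit Types (J : seq I).

Definition Lip f := exists L, lip L f.

(** [J] collects the axes already averaged over. Derivatives are required to be Lipschitz, not just
    continuous, because [smear_derive] passes a derivative through a further average only under a
    Lipschitz bound. *)
Definition reg1 J f := Lip f /\ forall j, j \in J ->
  exists2 df, (forall x, is_derive x (E j) f (df x)) & Lip df.

Definition reg2 J f := Lip f /\ forall j, j \in J ->
  exists2 df, (forall x, is_derive x (E j) f (df x)) & reg1 J df.

Lemma Lip_continuous f : Lip f -> continuous f.
Proof. by move=> [L /lip_continuous]. Qed.

Lemma Lip_smear i f : Lip f -> Lip (smear d (E i) f).
Proof. by move=> [L fL]; exists L; exact: lip_smear. Qed.

Lemma reg1_smear i J f : reg1 J f -> reg1 (i :: J) (smear d (E i) f).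
Proof.
move=> [fL fJ]; split=> [|j]; first exact: Lip_smear.
have cf := Lip_continuous fL.
rewrite inE => /predU1P[->|/fJ[df fdf dfL]].
- exists (dquo d (E i) f) => [x|]; first exact: smear_derive_self.
  by case: fL => L fL; exists (L / d); exact: lip_dquo.
- exists (smear d (E i) df) => [x|]; last exact: Lip_smear.
  by case: dfL => L dfL; exact: smear_derive dfL.
Qed.

Lemma reg1_dquo i J f : reg1 J f -> reg1 J (dquo d (E i) f).
Proof.
have Ld g : Lip g -> Lip (dquo d (E i) g).
  by move=> [L gL]; exists (L / d); exact: lip_dquo.
move=> [fL fJ]; split=> [|j /fJ[df fdf dfL]]; first exact: Ld.
by exists (dquo d (E i) df) => [x|]; [exact: dquo_derive|exact: Ld].
Qed.

Lemma sub_reg1 J J' f : {subset J' <= J} -> reg1 J f -> reg1 J' f.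
Proof. by move=> JJ' [fL fJ]; split=> // j /JJ'; exact: fJ. Qed.

(** Along the new axis the derivative of the outer average is a difference quotient of the inner
    one, which is itself differentiable along [i :: J]; hence two averages per axis. Derivatives
    along the old axes commute with both. *)
Lemma reg2_smear2 i J f : reg2 J f ->
  reg2 (i :: J) (smear d (E i) (smear d (E i) f)).
Proof.
move=> [fL fJ].
have Ls := Lip_smear i fL; split=> [|j]; first exact: Lip_smear.
have cf := Lip_continuous fL; have cs := Lip_continuous Ls.
rewrite inE => /predU1P[->|/fJ[df fdf dfJ]].
- exists (dquo d (E i) (smear d (E i) f)) => [x|]; first exact: smear_derive_self.
  apply/reg1_dquo/reg1_smear; split=> // k /fJ[df fdf [dfL _]].
  by exists df.
- have [L dfL] := dfJ.1.
  exists (smear d (E i) (smear d (E i) df)) => [x|].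
    have dsL : lip L (smear d (E i) df) by exact: lip_smear.
    have H y : is_derive y (E j) (smear d (E i) f) (smear d (E i) df y).
      exact: smear_derive dfL.
    exact: smear_derive dsL.
  apply: (sub_reg1 (J := i :: i :: J)); last by do 2 apply: reg1_smear.
  by move=> k; rewrite !inE orbA orbb.
Qed.

Definition smooth J f := foldr (fun i g => smear d (E i) (smear d (E i) g)) f J.

Lemma reg2_smooth J f : Lip f -> reg2 J (smooth J f).
Proof.
by move=> fL; elim: J => [|i J IH]; [split | exact: reg2_smear2].
Qed.

Lemma lip_smooth L J f : lip L f -> lip L (smooth J f).
Proof.
by move=> fL; elim: J => [|i J IH] //=; apply: lip_smear => //; exact: lip_smear.
Qed.

Lemma smooth_dist L J f x : lip L f ->
  `|smooth J f x - f x| <= (size J)%:R * (2 * L * d).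
Proof.
move=> fL; elim: J => [|i J IH] /=; first by rewrite subrr normr0 mul0r.
have gL := lip_smooth J fL; have g1 := lip_smear (E i) d0 gL.
have H1 := smear_dist d0 (E1 i) x g1; have H2 := smear_dist d0 (E1 i) x gL.
rewrite -natr1 mulrDl mul1r.
set a := smear _ _ _ _ in H1 *; set b := smear _ _ _ _ in H1 H2.
rewrite (_ : a - f x = (a - b) + (b - smooth J f x) + (smooth J f x - f x)).
  apply: (le_trans (ler_normD _ _)); rewrite addrC lerD//.
  by apply: (le_trans (ler_normD _ _)); lra.
by ring.
Qed.

Lemma midconv_smooth U r w L J f : lip L f -> midconv U r w f ->
  midconv U (r + (size J)%:R * (2 * d)) w (smooth J f).
Proof.
move=> fL fc; elim: J => [|i J IH] /=; first by rewrite mul0r addr0.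
have gL := lip_smooth J fL; have g1 := lip_smear (E i) d0 gL.
rewrite -natr1 mulrDl mul1r (_ : _ + (_ + 2 * d) =
  r + (size J)%:R * (2 * d) + d + d); last by ring.
apply: midconv_smear => //; first exact: lip_continuous g1.
by apply: midconv_smear => //; exact: lip_continuous gL.
Qed.

End Iterate.
End Smoothing.

(** * Combining directional derivatives; sign of a second derivative *)

Section DirectionalDerivatives.
Variables (R : realType) (V : normedModType R).
Implicit Types (f df g : V -> R) (x y v w e : V) (a c l h t s : R).

Lemma is_derive_opp_dir f x v l : is_derive x v f l -> is_derive x (- v) f (- l).
Proof.
move=> /is_derive_epsP H; apply/is_derive_epsP => k /H[b b0 bP].
exists b => // h hb; have := bP (- h); rewrite normrN => /(_ hb).
by rewrite scaleNr scalerN mulrN mulNr.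
Qed.

(** Move first by [h *: v], then by [(h * c) *: e]; the second increment is [h * c] times [df] at a
    nearby point, and continuity of [df] at [x] finishes. *)
Lemma is_derive_add_dir f df x v e a c : is_derive x v f a ->
  (forall y, is_derive y e f (df y)) -> {for x, continuous df} ->
  is_derive x (v + c *: e) f (a + c * df x).
Proof.
move=> /is_derive_epsP fv fe /cvgrPdist_le cdf; apply/is_derive_epsP => k k0.
have k2 : 0 < k / 2 by lra.
have [b1 b10 b1P] := fv _ k2.
have c1 : 0 < `|c| + 1 by have := normr_ge0 c; lra.
have kc : 0 < k / 2 / (`|c| + 1) by rewrite divr_gt0.
have /nbhs_ballP[b2 /= b20 b2P] := cdf _ kc.
pose N := `|v| + `|c| * `|e| + 1.
have N0 : 0 < N by rewrite ltr_wpDl// addr_ge0// mulr_ge0.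
exists (Num.min b1 (b2 / N)); first by rewrite lt_min b10 divr_gt0.
move=> h; rewrite lt_min => /andP[hb1]; rewrite ltr_pdivlMr// => hb2.
have [m mh fm] := MVT_line (x + h *: v) (h * c) fe.
have -> : f (x + h *: (v + c *: e)) - f x - h * (a + c * df x) =
  (f (x + h *: v) - f x - h * a) + h * c * (df (x + h *: v + m *: e) - df x).
  by rewrite mulrBr -fm scalerDr scalerA addrA; ring.
rewrite (le_trans (ler_normD _ _))//
  (_ : k * `|h| = k / 2 * `|h| + k / 2 * `|h|); last by field.
rewrite lerD ?b1P// !normrM.
have : `|df (x + h *: v + m *: e) - df x| <= k / 2 / (`|c| + 1).
  rewrite distrC; apply: b2P; rewrite -ball_normE /=.
  rewrite -addrA opprD addNKr normrN (le_lt_trans (ler_normD _ _))//.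
  rewrite !normrZ; apply: le_lt_trans hb2; rewrite /N !mulrDr mulr1 -addrA lerD2l.
  rewrite (le_trans (_ : _ <= `|h| * (`|c| * `|e|)))// ?lerDl//.
  by rewrite mulrA ler_wpM2r// -normrM.
rewrite ler_pdivlMr// => H.
rewrite -mulrA mulrC; apply: ler_wpM2r => //.
by apply: le_trans H; rewrite mulrC ler_wpM2l// lerDl.
Qed.

(** If [c < 0], the symmetric sum [p] has derivative at most [s * c < 0] at small [s > 0], so it
    drops below its value [2 * f x] at 0. *)
Lemma second_derivative_ge0 f g x w c (b : R) : 0 < b ->
  (forall y, is_derive y w f (g y)) -> is_derive x w g c ->
  (forall t, 0 < t < b -> 2 * f x <= f (x + t *: w) + f (x - t *: w)) -> 0 <= c.
Proof.
move=> b0 fg /is_derive_epsP gc fx; rewrite leNgt; apply/negP => c0.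
have c2 : 0 < - c / 2 by lra.
have [k k0 kP] := gc _ c2.
pose t := Num.min (k / 2) (b / 2).
have t0 : 0 < t by rewrite lt_min; apply/andP; split; lra.
have tk : t < k by rewrite gt_min; apply/orP; left; lra.
have tb : t < b by rewrite gt_min; apply/orP; right; lra.
pose p s := f (x + s *: w) + f (x + s *: (- w)).
pose q s := g (x + s *: w) - g (x + s *: (- w)).
have pq (s : R) : is_derive s 1 p (q s).
  have H1 := (is_derive_line f x w s _).1 (fg _).
  have H2 := (is_derive_line f x (- w) s _).1 (is_derive_opp_dir (fg _)).
  exact: (is_deriveD H1 H2).
have cp : {within `[0, t], continuous p}.
  exact: (@is_derive_within_continuous R _ q _ _ (fun s _ => pq s)).
have [s] := @MVT R p q 0 t t0 (fun s _ => pq s) cp.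
rewrite in_itv/= => /andP[s0 st] E.
have qs : q s < 0.
  have sk : `|s| < k by rewrite (gtr0_norm s0) (lt_trans st).
  have := kP s sk; have := kP (- s); rewrite normrN => /(_ sk).
  rewrite scaleNr /q scalerN (gtr0_norm s0) !ler_norml => /andP[H1 H2] /andP[H3 H4].
  have sc : s * c < 0 by rewrite pmulr_rlt0.
  lra.
have := fx t; rewrite t0 tb => /(_ isT).
have : p t - p 0 < 0 by rewrite E subr0 pmulr_llt0.
rewrite /p !scale0r !addr0 scalerN; lra.
Qed.

End DirectionalDerivatives.

(** * Hessians as quadratic forms, quadratic test functions, C2 criteria *)

Section Hessian.
Variables (R : realType) (n : nat).
Local Notation V := 'rV[R]_n.
Local Notation E i := (delta_mx 0 i : V).
Implicit Types (f g : V -> R) (x y w : V) (M : 'M[R]_n).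

(** The direction is built up one coordinate at a time, by induction along the sum
    [\sum_i w 0 i *: E i]. *)
Lemma is_derive_gradient f (df : 'I_n -> V -> R) x w :
  (forall i y, is_derive y (E i) f (df i y)) ->
  (forall i, continuous (df i)) ->
  is_derive x w f (\sum_i w 0 i * df i x).
Proof.
move=> fdf cdf; rewrite {1}(row_sum_delta w).
elim: (index_enum _) => [|i s IH]; first by rewrite !big_nil; exact: is_derive0.
rewrite !big_cons addrC [X in is_derive _ _ _ X]addrC.
by apply: is_derive_add_dir => //; exact: cdf.
Qed.

Lemma C2_hessian f (df : 'I_n -> V -> R) (ddf : 'I_n -> 'I_n -> V -> R) :
  continuous f ->
  (forall i x, is_derive x (E i) f (df i x)) -> (forall i, continuous (df i)) ->
  (forall i j x, is_derive x (E j) (df i) (ddf i j x)) ->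
  (forall i j, continuous (ddf i j)) ->
  C2 f /\ forall x, hessian f x = \matrix_(i, j) ddf j i x.
Proof.
move=> cf fdf cdf fddf cddf.
have pE i : partial i f = df i by apply: funext => x; exact: derive_val.
have ppE i j : partial j (df i) = ddf i j by apply: funext => x; exact: derive_val.
split; last by move=> x; apply/matrixP => i j; rewrite !mxE pE ppE.
split=> // i; rewrite pE; split; first by move=> x; exact: ex_derive.
by split=> // j; rewrite ppE; split=> // x; exact: ex_derive.
Qed.

Lemma C2_partials f : C2 f -> [/\ continuous f,
  forall i x, is_derive x (E i) f (partial i f x),
  forall i, continuous (partial i f),
  forall i j x, is_derive x (E j) (partial i f) (partial j (partial i f) x) &
  forall i j, continuous (partial j (partial i f))].
Proof.
move=> [cf fC]; split=> //.
- by move=> i x; have [ex _] := fC i; exact/derivableP/ex.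
- by move=> i; have [_ []] := fC i.
- by move=> i j x; have [_ [_ /(_ j)[ex _]]] := fC i; exact/derivableP/ex.
- by move=> i j; have [_ [_ /(_ j)[]]] := fC i.
Qed.

Lemma qformE M w : qform M w = \sum_i w 0 i * \sum_j w 0 j * M j i.
Proof.
rewrite /qform mxE; apply: eq_bigr => i _; rewrite !mxE mulrC; congr (_ * _).
Qed.

Lemma qform_hessian_ge0 f x w (b : R) : C2 f -> 0 < b ->
  (forall t, 0 < t < b -> 2 * f x <= f (x + t *: w) + f (x - t *: w)) ->
  0 <= qform (hessian f x) w.
Proof.
move=> /C2_partials[_ fd fc fdd fddc] b0 fx.
pose g y := \sum_i w 0 i * partial i f y.
have fg y : is_derive y w f (g y) by exact: is_derive_gradient.
apply: (second_derivative_ge0 b0 fg _ fx).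
rewrite qformE (_ : \sum_i _ = \sum_i w 0 i *: \sum_j w 0 j * partial j (partial i f) x).
  rewrite (_ : g = \sum_i (w 0 i \*: partial i f)).
    by apply: is_derive_sum => i; apply: is_deriveZ; exact: is_derive_gradient.
  by apply: funext => y; rewrite fct_sumE.
by apply: eq_bigr => i _; congr (_ * _); apply: eq_bigr => j _; rewrite mxE.
Qed.

Lemma qformD M N w : qform (M + N) w = qform M w + qform N w.
Proof. by rewrite /qform mulmxDr mulmxDl mxE. Qed.

Lemma qform_tr M w : qform M^T w = qform M w.
Proof.
have -> : qform M^T w = (w *m M *m w^T)^T 0 0 by rewrite !trmx_mul trmxK mulmxA.
by rewrite mxE.
Qed.

Lemma qform_expand M x w (h : R) : qform M (x + h *: w) =
  qform M x + h * (x *m (M + M^T) *m w^T) 0 0 + h ^+ 2 * qform M w.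
Proof.
have E : (x *m M^T *m w^T) 0 0 = (w *m M *m x^T) 0 0.
  have -> : x *m M^T *m w^T = (w *m M *m x^T)^T by rewrite !trmx_mul trmxK mulmxA.
  by rewrite mxE.
have D (A B : 'M[R]_1) : (A + B) 0 0 = A 0 0 + B 0 0 by rewrite mxE.
have Z (k : R) (A : 'M[R]_1) : (k *: A) 0 0 = k * A 0 0 by rewrite mxE.
rewrite /qform mulmxDr !mulmxDl linearD linearZ /= !mulmxDr -!scalemxAl -!scalemxAr.
by rewrite !D !Z E; ring.
Qed.

Lemma mulcol_continuous (A : 'cV[R]_n) : continuous (fun x : V => (x *m A) 0 0).
Proof.
rewrite (_ : (fun _ => _) = (fun x : V => \sum_i x 0 i * A i 0)); last first.
  by apply: funext => x; rewrite mxE.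
apply: continuous_big => [|i _ x]; first exact: add_continuous.
by apply: continuousM; [exact: coord_continuous|exact: cst_continuous].
Qed.

Lemma qform_continuous M : continuous (qform M).
Proof.
rewrite (_ : qform M = (fun x : V => \sum_i (x *m col i M) 0 0 * x 0 i)); last first.
  apply: funext => x; rewrite /qform mxE; apply: eq_bigr => i _.
  by rewrite !mxE; congr (_ * _); apply: eq_bigr => j _; rewrite !mxE.
apply: continuous_big => [|i _ x]; first exact: add_continuous.
by apply: continuousM; [exact: mulcol_continuous|exact: coord_continuous].
Qed.

Definition quad x0 (c : R) (b : 'cV[R]_n) M x : R :=
  c + ((x - x0) *m b) 0 0 + qform M (x - x0).

Lemma quad_C2 x0 c b M :
  C2 (quad x0 c b M) /\ forall x, hessian (quad x0 c b M) x = M + M^T.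
Proof.
have cB : continuous (fun x : V => x - x0).
  by move=> x; apply: continuousB; [exact: id|exact: cst_continuous].
pose lin (A : 'cV[R]_n) x := ((x - x0) *m A) 0 0.
have clin A : continuous (lin A).
  by move=> x; exact: (continuous_comp (cB x) (@mulcol_continuous A _)).
pose dq i x := (E i *m b) 0 0 + ((x - x0) *m ((M + M^T) *m (E i)^T)) 0 0.
pose ddq i j (x : V) := (E j *m ((M + M^T) *m (E i)^T)) 0 0.
have [|||||qC qH] := @C2_hessian (quad x0 c b M) dq ddq.
- have -> : quad x0 c b M = (fun=> c) + lin b + (fun x => qform M (x - x0)) by [].
  move=> x; apply: continuousD; last exact: (continuous_comp (cB x) (@qform_continuous _ _)).
  by apply: continuousD; [exact: cst_continuous|exact: clin].
- move=> i x; apply/is_derive_epsP => k k0.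
  have q0 : 0 < `|qform M (E i)| + 1 by rewrite ltr_wpDl.
  exists (k / (`|qform M (E i)| + 1)); first by rewrite divr_gt0.
  move=> h; rewrite ltr_pdivlMr// => hk.
  rewrite /quad (addrAC x) qform_expand mulmxDl -scalemxAl.
  have -> : ((x - x0) *m b + h *: (E i *m b)) 0 0 =
    ((x - x0) *m b) 0 0 + h * (E i *m b) 0 0 by rewrite !mxE.
  rewrite (_ : _ - _ = h * (h * qform M (E i))); last by rewrite /dq mulmxA; ring.
  rewrite !normrM mulrC ler_wpM2r//.
  by move: hk; rewrite mulrDr mulr1; have := normr_ge0 h; lra.
- move=> i; have -> : dq i = (fun=> (E i *m b) 0 0) + lin ((M + M^T) *m (E i)^T) by [].
  by move=> x; apply: continuousD; [exact: cst_continuous|exact: clin].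
- move=> i j x; apply/is_derive_epsP => k k0; exists 1 => // h _.
  rewrite /dq /ddq (addrAC x) mulmxDl -scalemxAl.
  set A := (x - x0) *m _; set B := E j *m _.
  have -> : (A + h *: B) 0 0 = A 0 0 + h * B 0 0 by rewrite !mxE.
  rewrite (_ : _ - _ = 0); last by ring.
  by rewrite normr0 mulr_ge0// ltW.
- by move=> i j x; exact: cst_continuous.
split=> // x; rewrite qH; apply/matrixP => i j; rewrite mxE /ddq.
by rewrite mulmxA -rowE trmx_delta -colE !mxE.
Qed.

Lemma C2D f g : C2 f -> C2 g -> C2 (fun x => f x + g x) /\
  forall x, hessian (fun x => f x + g x) x = hessian f x + hessian g x.
Proof.
move=> /C2_partials[cf f1 f1c f2 f2c] /C2_partials[cg g1 g1c g2 g2c].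
pose dq i x := partial i f x + partial i g x.
pose ddq i j x := partial j (partial i f) x + partial j (partial i g) x.
have cD h k : continuous h -> continuous k -> continuous (fun x : V => h x + k x : R).
  by move=> ch ck x; apply: continuousD; [exact: ch|exact: ck].
have qP := @C2_hessian (fun x => f x + g x) dq ddq.
have [] := qP (cD _ _ cf cg) (fun i x => is_deriveD (f1 i x) (g1 i x))
  (fun i => cD _ _ (f1c i) (g1c i)) (fun i j x => is_deriveD (f2 i j x) (g2 i j x))
  (fun i j => cD _ _ (f2c i j) (g2c i j)).
by move=> qC qH; split=> // x; rewrite qH; apply/matrixP => i j; rewrite !mxE.
Qed.

Lemma reg2_C2 f : reg2 (fun i => E i) (enum 'I_n) f -> C2 f.
Proof.
move=> [fL fJ].
have {fJ} fJ i : exists2 df, (forall x, is_derive x (E i) f (df x)) &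
    reg1 (fun i => E i) (enum 'I_n) df by apply: fJ; rewrite mem_enum.
have pE i : exists2 df, (forall x, is_derive x (E i) f (df x)) &
    reg1 (fun i => E i) (enum 'I_n) df /\ partial i f = df.
  have [df fdf r] := fJ i; exists df => //; split=> //.
  by apply: funext => x; exact: derive_val.
split=> [|i]; first exact: Lip_continuous.
have [df fdf [[dfL dfJ] ->]] := pE i.
split; first by move=> x; exact: ex_derive.
split=> [|j]; first exact: Lip_continuous.
have [|ddf fddf ddfL] := dfJ j; first by rewrite mem_enum.
rewrite (_ : partial j df = ddf); last by apply: funext => x; exact: derive_val.
by split; [move=> x; exact: ex_derive|exact: Lip_continuous].
Qed.

Lemma norm_delta_le1 i : `|E i| <= 1.
Proof.
rewrite [leLHS]mx_normrE; apply/bigmax_leP; split=> // -[a j] _ /=.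
by rewrite mxE; case: (_ && _); rewrite ?normr1 ?normr0.
Qed.

End Hessian.

(** * Semicontinuous functions on compact sets *)

Section Semicontinuity.
Variables (R : realType) (n : nat).
Local Notation V := 'rV[R]_n.
Implicit Types (K : set V) (u h : V -> R) (x y : V).

Lemma usc_bounded K h : compact K -> usc_on K h ->
  exists M : R, forall y, K y -> h y <= M.
Proof.
move=> /compact_near_coveringP cK uh.
have H x : K x -> \forall x' \near x & M \near +oo%R, K x' -> h x' <= M.
  move=> Kx; exists ([set y | K y -> h y < h x + 1], [set M | h x + 1 <= M]).
    by split; [exact: uh|apply: nbhs_pinfty_ge; exact: num_real].
  by move=> [y M] [/= hy hM] Ky; exact: (le_trans (ltW (hy Ky))).
have cK' := cK _ _ _ (@filter_filter R _ proper_pinfty_nbhs) H.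
have /filter_ex[M hM] := cK'.
by exists M => y Ky; exact: hM.
Qed.

Lemma usc_max K h : compact K -> K !=set0 -> usc_on K h ->
  exists2 x, K x & forall y, K y -> h y <= h x.
Proof.
move=> cK [k0 Kk0] uh; have [M hM] := usc_bounded cK uh.
have hs : has_sup (h @` K).
  by split; [exists (h k0), k0|exists M => _ [y Ky <-]; exact: hM].
have ub y : K y -> h y <= sup (h @` K).
  by move=> Ky; apply: sup_upper_bound => //; exists y.
have [//|no] := pselect (exists2 x, K x & forall y, K y -> h y <= h x).
have lt y : K y -> h y < sup (h @` K).
  move=> Ky; rewrite lt_neqAle ub// andbT; apply/eqP => E.
  by apply: no; exists y => // z Kz; rewrite E ub.
(* If the supremum is not attained, each point has a neighbourhood on which [h] misses it by a fixed
   amount; compactness makes the amount uniform, against the definition of the supremum. *)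
have H x : K x -> \forall x' \near x & e \near (0 : R)^'+,
    K x' -> h x' <= sup (h @` K) - e.
  move=> Kx; pose e := (sup (h @` K) - h x) / 2.
  have e0 : 0 < e by have := lt _ Kx; rewrite /e; lra.
  exists ([set y | K y -> h y < h x + e], [set e' | e' <= e]).
    by split; [exact: uh|exact: nbhs_right_le].
  move=> [y e'] [/= hy he] Ky; have := hy Ky; rewrite /e in he *; lra.
move/compact_near_coveringP : cK => cK.
have cK' := cK _ _ _ (@filter_filter R _ (at_right_proper_filter _)) H.
near (0 : R)^'+ => e.
have e0 : 0 < e by [].
have he : K `<=` (fun y => K y -> h y <= sup (h @` K) - e) by near: e.
have [_ [y Ky <-]] := sup_adherent e0 hs; have := he y Ky Ky => /= *; lra.
Unshelve. all: by end_near. Qed.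

Lemma usc_onB K u h : usc_on K u -> lsc_on K h -> usc_on K (fun x => u x - h x).
Proof.
move=> uu lh x Kx e e0; have e2 : 0 < e / 2 by lra.
apply: filterS2 (uu _ Kx _ e2) (lh _ Kx _ e2) => y uy hy Ky.
by have := uy Ky; have := hy Ky; lra.
Qed.

Lemma sub_usc_on K K' u : K' `<=` K -> usc_on K u -> usc_on K' u.
Proof.
move=> KK uu x /KK Kx e /(uu _ Kx); apply: filterS => y + /KK; exact.
Qed.

Lemma continuous_usc_on K u : continuous u -> usc_on K u.
Proof.
move=> cu x _ e e0; have /cvgrPdist_lt/(_ _ e0) := cu x.
by apply: filterS => y; rewrite ltr_distl => /andP[H1 H2] _; lra.
Qed.

Lemma continuous_lsc_on K u : continuous u -> lsc_on K u.
Proof.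
move=> cu x _ e e0; have /cvgrPdist_lt/(_ _ e0) := cu x.
by apply: filterS => y; rewrite ltr_distl => /andP[H1 H2] _; lra.
Qed.

End Semicontinuity.

(** * Sup-convolution with a linear penalty *)

Section SupConvolution.
Variables (R : realType) (n : nat).
Local Notation V := 'rV[R]_n.
Variables (K : set V) (u : V -> R) (L M : R).
Hypotheses (K0 : K !=set0) (uM : forall y, K y -> - M <= u y <= M) (L0 : 0 <= L).

(** For [u] bounded on a nonempty [K], this is the least [L]-Lipschitz function on the whole space
    that dominates [u] on [K]. *)
Definition supconv (x : V) : R := sup [set u y - L * `|x - y| | y in K].

Let hs x : has_sup [set u y - L * `|x - y| | y in K].
Proof.
case: K0 => k Kk; split; first by exists (u k - L * `|x - k|), k.
exists M => _ [y Ky <-]; have /andP[_ H] := uM Ky.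
by have := mulr_ge0 L0 (normr_ge0 (x - y)); lra.
Qed.

Lemma supconv_ge x y : K y -> u y - L * `|x - y| <= supconv x.
Proof. by move=> Ky; apply: sup_upper_bound => //; exists y. Qed.

Lemma supconv_le x (c : R) :
  (forall y, K y -> u y - L * `|x - y| <= c) -> supconv x <= c.
Proof.
move=> H; apply: ge_sup; first by have [] := hs x.
by move=> _ [y Ky <-]; exact: H.
Qed.

Lemma supconv_approx x (e : R) : 0 < e ->
  exists2 y, K y & supconv x - e < u y - L * `|x - y|.
Proof.
by move=> e0; have [_ [y Ky <-] H] := sup_adherent e0 (hs x); exists y.
Qed.

Lemma lip_supconv : lip L supconv.
Proof.
split=> // x y.
have H a b : supconv a <= supconv b + L * `|a - b|.
  apply: supconv_le => z Kz; have := supconv_ge b Kz.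
  have : L * `|b - z| <= L * `|a - z| + L * `|a - b|.
    by rewrite -mulrDr ler_wpM2l// [leRHS]addrC (distrC a b) ler_distD.
  lra.
by rewrite ler_distl; have := H x y; have := H y x; rewrite (distrC y x); lra.
Qed.

(** A competitor [y] within [r] of [x] is moved along with the segment: [y + t *: w] and
    [y - t *: w] compete at the two ends with the same penalty, and convexity of [u] at [y]
    applies. *)
Lemma midconv_supconv (U : set V) (r : R) w : U `<=` K -> 0 <= r ->
  2 * M <= L * r -> midconv U 0 w u -> midconv U r w supconv.
Proof.
move=> UK r0 ML uc x t xU.
have UZ z s : `|z| <= r -> `|s| <= `|t *: w| -> U (x + z + s).
  move=> zr st; rewrite -addrA; apply: xU.
  by rewrite (le_trans (ler_normD _ _))// lerD.
have U1 z : `|z| <= r -> K (x + t *: w + z).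
  by move=> zr; rewrite addrAC; apply/UK/UZ.
have U2 z : `|z| <= r -> K (x - t *: w + z).
  by move=> zr; rewrite addrAC; apply/UK/UZ => //; rewrite normrN.
rewrite mulrC -ler_pdivlMr//; apply: supconv_le => y Ky.
have [zr|zr] := leP `|y - x| r.
- have := uc (x + (y - x)) t.
  rewrite subrKC => /(_ _)H.
  have {}H : 2 * u y <= u (y + t *: w) + u (y - t *: w).
    by apply: H => s; rewrite add0r => ts; have := UZ _ _ zr ts; rewrite subrKC.
  have E1 s : x + s + (y - x) = y + s by rewrite addrAC subrKC.
  have := supconv_ge (x + t *: w) (U1 _ zr); have := supconv_ge (x - t *: w) (U2 _ zr).
  rewrite !E1 !opprD !addrA.
  have -> : x + t *: w - y - t *: w = x - y by rewrite addrAC addrK.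
  have -> : x - t *: w - y - - (t *: w) = x - y by rewrite opprK addrAC subrK.
  lra.
(* For distant [y] the penalty exceeds [2 * M], so its contribution is at most [- M], a lower bound
   for [u] at both ends. *)
- have [] : K (x + t *: w) /\ K (x - t *: w).
    have z0 : `|0 : V| <= r by rewrite normr0.
    by have := U1 _ z0; have := U2 _ z0; rewrite !addr0.
  move=> Kp Km.
  have := supconv_ge (x + t *: w) Kp; have := supconv_ge (x - t *: w) Km.
  rewrite !subrr normr0 mulr0 !subr0.
  have /andP[H1 _] := uM Kp; have /andP[H2 _] := uM Km; have /andP[_ H3] := uM Ky.
  have : L * r <= L * `|x - y| by rewrite distrC ler_wpM2l// ltW.
  lra.
Qed.

End SupConvolution.

(** * Viscosity subsolutions are midpoint convex along the directions *)

Section ViscosityConvexity.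
Variables (R : realType) (n : nat).
Local Notation V := 'rV[R]_n.
Implicit Types (x y z w d : V) (M : 'M[R]_n).

Lemma eucl_sq_ge0 m (z : 'rV[R]_m) : 0 <= eucl_sq z.
Proof. by apply: sumr_ge0 => i _; exact: sqr_ge0. Qed.

Lemma norm_le_eucl z : `|z| ^+ 2 <= eucl_sq z.
Proof.
have [z0|/mx_norm_neq0[[a i] /= zi]] := eqVneq (mx_norm z) 0.
  by rewrite [`|z|]z0 expr0n /=; exact: eucl_sq_ge0.
rewrite [`|z|]zi (ord1 a) real_normK ?num_real// /eucl_sq (bigD1 i)//= lerDl.
by apply: sumr_ge0 => j _; exact: sqr_ge0.
Qed.

Lemma eucl_sq_gt0 z : z != 0 -> 0 < eucl_sq z.
Proof. by move=> z0; apply: lt_le_trans (norm_le_eucl z); rewrite exprn_gt0// normr_gt0. Qed.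

Lemma eucl_sqE m (z : 'rV[R]_m) : eucl_sq z = (z *m z^T) 0 0.
Proof. by rewrite /eucl_sq mxE; apply: eq_bigr => i _; rewrite !mxE expr2. Qed.

Lemma qform_gram m (A : 'M[R]_(n, m)) z : qform (A *m A^T) z = eucl_sq (z *m A).
Proof. by rewrite eucl_sqE /qform trmx_mul !mulmxA. Qed.

Lemma qformZ M (t : R) z : qform M (t *: z) = t ^+ 2 * qform M z.
Proof.
by rewrite /qform linearZ /= -!scalemxAl -scalemxAr scalerA [LHS]mxE expr2.
Qed.

Lemma qformZl M (t : R) z : qform (t *: M) z = t * qform M z.
Proof. by rewrite /qform -scalemxAr -scalemxAl mxE. Qed.

Lemma closed_ball_compact x (r : R) : 0 < r -> compact (closed_ball x r).
Proof.
move=> r0; apply: bounded_closed_compact; last exact: closed_ball_closed.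
exists (`|x| + r); split=> [|M xM y]; first exact: num_real.
rewrite closed_ballE// /closed_ball_ /= => xy; apply: le_trans (ltW xM).
by have := ler_normB x (x - y); rewrite subKr; lra.
Qed.

Lemma lambdaD_ge0 (Dset : set V) M w : (- lambdaD Dset M <= 0)%E ->
  Dset w -> w != 0 -> 0 <= qform M w.
Proof.
rewrite oppe_le0 => l0 Dw w0.
have : (lambdaD Dset M <= (qform M w / eucl_sq w)%:E)%E.
  by apply: ereal_inf_lbound; exists w.
move=> /(le_trans l0); rewrite lee_fin.
by rewrite pmulr_lge0// invr_gt0 eucl_sq_gt0.
Qed.

(* A strict failure of midpoint convexity on [x - d, x + d] is detected by a
   quadratic which is concave along [d] and steep in the orthogonal directions:
   the maximum of [u - phi] on the ball then lies close to the axis, but not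
   near the two end points, hence in the interior. *)
Lemma visc_sub_midconv (Omega Dset : set V) (g u : V -> R) w :
  usc_on (closure Omega) u -> visc_sub Dset g Omega u -> Dset w -> ~ Dset 0 ->
  midconv Omega 0 w u.
Proof.
move=> uu us Dw D0 x t; set d := t *: w => xO.
have w0 : w != 0 by apply: contraPneq Dw => ->.
rewrite leNgt; apply/negP => ud.
have d0 : d != 0.
  by apply/eqP => d0; move: ud; rewrite d0 addr0 subr0; lra.
have nd0 : 0 < `|d| by rewrite normr_gt0.
have ed0 := eucl_sq_gt0 d0.
(* Along the axis, [psi] is the affine interpolation of [u] at the end points, raised by [2 * eta]
   and bent by [- eta * l ^+ 2]. Hence [u - psi] is [- eta] at both ends and [2 * eta] at the
   centre. *)
pose m := (u (x + d) + u (x - d)) / 2.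
pose sg := (u (x + d) - u (x - d)) / 2.
pose eta := (u x - m) / 4.
have eta0 : 0 < eta by rewrite /eta /m; lra.
(* [l] is the Euclidean coordinate along [d], and [Q] below is the orthogonal projection that kills
   [d]. *)
pose a : 'cV[R]_n := (eucl_sq d)^-1 *: d^T.
pose l z := (z *m a) 0 0.
have ld : l d = 1.
  by rewrite /l /a -scalemxAr mxE -eucl_sqE mulVf// gt_eqF.
have lN z : l (- z) = - l z by rewrite /l mulNmx mxE.
pose Q := 1%:M - a *m d.
have QE z : z *m Q = z - l z *: d.
  by rewrite /Q mulmxBr mulmx1 mulmxA [z *m a]mx11_scalar mul_scalar_mx.
have dQ : d *m Q = 0 by rewrite QE ld scale1r subrr.
have la z : qform (a *m a^T) z = l z ^+ 2.
  by rewrite qform_gram /eucl_sq big_ord1.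
pose psi p := quad x (m + 2 * eta) (sg *: a) (- eta *: (a *m a^T)) p.
have psiE p : psi p = m + 2 * eta + sg * l (p - x) - eta * l (p - x) ^+ 2.
  by rewrite /psi /quad -scalemxAr mxE qformZl la mulNr.
have cpsi : continuous psi.
  by have [[]] := quad_C2 x (m + 2 * eta) (sg *: a) (- eta *: (a *m a^T)).
pose B := closed_ball x `|d|.
have BE p : B p <-> `|p - x| <= `|d|.
  by rewrite /B closed_ballE// /closed_ball_ /= distrC.
have BO : B `<=` Omega.
  by move=> p /BE px; rewrite -(subrKC x p); apply: xO; rewrite add0r.
have BK : B `<=` closure Omega by move=> p /BO; exact: subset_closure.
have cB : compact B by exact: closed_ball_compact.
have Bx : B x by apply/BE; rewrite subrr normr0.
have uB := sub_usc_on BK uu.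
have up : usc_on B (fun p => u p - psi p).
  by apply: usc_onB => //; exact: continuous_lsc_on.
have [S0 S0P] := usc_bounded cB up.
pose S := Num.max S0 1.
have S1 : 0 < S by rewrite /S lt_max ltr01 orbT.
have SP p : B p -> u p - psi p <= S.
  by move=> /S0P pS; rewrite /S le_max pS.
have Bp : B (x + d) by apply/BE; rewrite addrC addKr.
have Bm : B (x - d) by apply/BE; rewrite addrC addKr normrN.
have pp : u (x + d) - psi (x + d) = - eta.
  by rewrite psiE (addrAC x) subrr add0r ld /m /sg; lra.
have pm : u (x - d) - psi (x - d) = - eta.
  by rewrite psiE (addrAC x) subrr add0r lN ld sqrrN /m /sg; lra.
have /nbhs_ballP[r1 /= r10 r1P] := up _ Bp _ eta0.
have /nbhs_ballP[r2 /= r20 r2P] := up _ Bm _ eta0.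
pose r := Num.min r1 r2.
have r0 : 0 < r by rewrite lt_min r10 r20.
have near_end p : B p -> `|p - (x + d)| < r \/ `|p - (x - d)| < r ->
    u p - psi p < 0.
  move=> pB [] pr.
    have := r1P p; rewrite -ball_normE /= distrC pp addNr; apply=> //.
    by apply: lt_le_trans pr _; rewrite /r ge_min lexx.
  have := r2P p; rewrite -ball_normE /= distrC pm addNr; apply=> //.
  by apply: lt_le_trans pr _; rewrite /r ge_min lexx orbT.
(* Where [u - phi] is positive, [k] times the squared distance to the axis is less than [S], so that
   distance is below [r / 3]. *)
pose k := S / (r / 3) ^+ 2.
have r3 : 0 < (r / 3) ^+ 2 by rewrite exprn_gt0//; lra.
have k0 : 0 < k by rewrite /k divr_gt0.
pose M := - eta *: (a *m a^T) + k *: (Q *m Q^T).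
pose phi := quad x (m + 2 * eta) (sg *: a) M.
have phiE p : phi p = psi p + k * eucl_sq ((p - x) *m Q).
  by rewrite /phi /psi /quad qformD [qform (k *: _) _]qformZl qform_gram addrA.
have [phiC phiH] := quad_C2 x (m + 2 * eta) (sg *: a) M.
have uphi : usc_on B (fun p => u p - phi p).
  by apply: usc_onB => //; apply: continuous_lsc_on; case: phiC.
have [p pB pmax] := usc_max cB (ex_intro _ x Bx) uphi.
have ux : u x - phi x = 2 * eta.
  rewrite phiE psiE subrr mul0mx /l mul0mx mxE eucl_sqE mul0mx mxE.
  by rewrite /eta; lra.
have upos : 0 < u p - phi p by have := pmax _ Bx; lra.
have e0 := eucl_sq_ge0 ((p - x) *m Q).
have pQ : `|(p - x) *m Q| < r / 3.
  have ke : k * eucl_sq ((p - x) *m Q) < S.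
    by have := SP _ pB; rewrite phiE in upos; lra.
  have : eucl_sq ((p - x) *m Q) < (r / 3) ^+ 2.
    by move: ke; rewrite /k mulrAC ltr_pdivrMr// ltr_pM2l.
  move=> /(le_lt_trans (norm_le_eucl _)).
  by rewrite ltr_pXn2r// nnegrE//; lra.
(* On the sphere, a point within [r / 3] of the axis has axial part of norm within [r / 3] of [|d|];
   it is thus within [2 * r / 3] of an end, where [u - psi < 0]. *)
have pin : `|p - x| < `|d|.
  rewrite lt_neqAle (iffLR (BE p) pB) andbT; apply/eqP => pd.
  have kp : 0 <= k * eucl_sq ((p - x) *m Q) by rewrite mulr_ge0// ltW.
  suff : u p - psi p < 0 by rewrite phiE in upos; lra.
  apply: near_end => //; set lp := l (p - x).
  have pE : p - x = (p - x) *m Q + lp *: d by rewrite QE subrK.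
  have H1 : `|lp| * `|d| <= `|d| + `|(p - x) *m Q|.
    rewrite -normrZ -[in leRHS]pd.
    have -> : lp *: d = (p - x) - (p - x) *m Q by rewrite QE subKr.
    exact: ler_normB.
  have H2 : `|d| <= `|(p - x) *m Q| + `|lp| * `|d|.
    by rewrite -normrZ -[leLHS]pd {1}pE ler_normD.
  have [lp0|lp0] := leP 0 lp.
  - left.
    have -> : p - (x + d) = (p - x) *m Q + (lp - 1) *: d.
      by rewrite opprD addrA {1}pE scalerBl scale1r addrA.
    apply: (le_lt_trans (ler_normD _ _)); rewrite normrZ.
    have : `|lp - 1| * `|d| <= `|(p - x) *m Q|.
      rewrite ger0_norm in H1 H2 => //.
      have [l1|l1] := leP 1 lp.
        by rewrite ger0_norm ?mulrBl ?mul1r; lra.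
      by rewrite ltr0_norm ?opprB ?mulrBl ?mul1r; lra.
    by lra.
  - right.
    have -> : p - (x - d) = (p - x) *m Q + (lp + 1) *: d.
      by rewrite opprB addrCA addrC {1}pE scalerDl scale1r addrA.
    apply: (le_lt_trans (ler_normD _ _)); rewrite normrZ.
    have : `|lp + 1| * `|d| <= `|(p - x) *m Q|.
      rewrite ltr0_norm in H1 H2 => //.
      have [l1|l1] := leP 0 (lp + 1).
        by rewrite ger0_norm ?mulrDl ?mul1r; lra.
      by rewrite ltr0_norm ?opprD ?mulrDl ?mulNr ?mul1r; lra.
    by lra.
have pmx : local_max (fun y => u y - phi y) p.
  have : nbhs p (ball x `|d|).
    apply: open_nbhs_nbhs; split; first exact: ball_open.
    by rewrite -ball_normE /= distrC.
  apply: filterS => y; rewrite -ball_normE /= => yx; apply: pmax.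
  by apply/BE; rewrite distrC ltW.
have [_ /lambdaD_ge0/(_ Dw w0)] := us _ _ phiC (BO _ pB) pmx.
rewrite phiH qformD qform_tr => Hw.
(* Rescaled from [w] to [d], the form equals [- 2 * eta]: the steep term vanishes because
   [d *m Q = 0]. *)
have : 0 <= t ^+ 2 * (qform M w + qform M w) by rewrite mulr_ge0// sqr_ge0.
rewrite mulrDr -qformZ -/d /M qformD [qform (k *: _) _]qformZl qform_gram dQ.
rewrite qformZl la ld eucl_sqE mul0mx mxE; lra.
Qed.

End ViscosityConvexity.

(** * The obstacle bound and the comparison argument *)

Section Comparison.
Variables (R : realType) (n : nat).
Local Notation V := 'rV[R]_n.
Implicit Types (K Omega Dset : set V) (g u v : V -> R) (x y z w : V).

Lemma compact_uniform_radius K (Q : R -> V -> Prop) : compact K ->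
  (forall x, K x -> exists2 rho : R, 0 < rho & forall x' r,
     K x' -> `|x - x'| < rho -> 0 < r < rho -> Q r x') ->
  exists2 r : R, 0 < r & forall x, K x -> Q r x.
Proof.
move=> /compact_near_coveringP cK HQ.
have H x : K x -> \forall x' \near x & r \near (0 : R)^'+, K x' -> Q r x'.
  move=> Kx; have [rho rho0 rhoP] := HQ _ Kx.
  exists (ball x rho, [set r | 0 < r < rho]) => /=.
    split; first exact: nbhsx_ballx.
    by near=> r; apply/andP; split.
  by move=> [x' r] [/=]; rewrite -ball_normE /= => xx' r0 Kx'; exact: rhoP.
have cK' := cK _ _ _ (@filter_filter R _ (at_right_proper_filter _)) H.
near (0 : R)^'+ => r.
exists r => // x Kx.
have KQ : K `<=` (fun y => K y -> Q r y) by near: r.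
exact: KQ.
Unshelve. all: by end_near. Qed.

(** A steep paraboloid centred at [x] forces a maximum at some [p] near [x], where the test gives
    [u p <= g p]; moreover [u x <= u p], and continuity of [g] brings the bound back to [x]. *)
Lemma visc_sub_le Omega Dset g u x : open Omega -> continuous g ->
  usc_on (closure Omega) u -> visc_sub Dset g Omega u -> Omega x -> u x <= g x.
Proof.
move=> oO cg uu us Ox; apply/ler_addgt0Pr => e e0.
have /cvgrPdist_lt/(_ _ e0)/nbhs_ballP[r1 /= r10 r1P] := cg x.
have /nbhs_ballP[r2 /= r20 r2P] : nbhs x Omega by exact: open_nbhs_nbhs.
pose r := Num.min r1 r2 / 2.
have r12 : 0 < Num.min r1 r2 by rewrite lt_min r10 r20.
have r0 : 0 < r by rewrite /r; lra.
have le1 : Num.min r1 r2 <= r1 by rewrite ge_min lexx.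
have le2 : Num.min r1 r2 <= r2 by rewrite ge_min lexx orbT.
have rr1 : r < r1 by rewrite /r; lra.
have rr2 : r < r2 by rewrite /r; lra.
pose B := closed_ball x r.
have BE p : B p <-> `|p - x| <= r.
  by rewrite /B closed_ballE// /closed_ball_ /= distrC.
have cB : compact B by exact: closed_ball_compact.
have Bx : B x by apply/BE; rewrite subrr normr0 ltW.
have BO : B `<=` Omega.
  by move=> p /BE px; apply: r2P; rewrite -ball_normE /= distrC; exact: le_lt_trans rr2.
have BK : B `<=` closure Omega by move=> p /BO; exact: subset_closure.
have uB := sub_usc_on BK uu; have [S SP] := usc_bounded cB uB.
have Sx := SP _ Bx.
(* On the sphere of radius [r] the penalty is at least [S - u x + 1], leaving [u - phi] at most
   [u x - 1], below its value at the centre. *)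
pose k := (S - u x + 1) / r ^+ 2.
have k0 : 0 < k by rewrite divr_gt0 ?exprn_gt0//; lra.
pose phi := quad x 0 0 k%:M.
have phiE p : phi p = k * eucl_sq (p - x).
  rewrite /phi /quad mulmx0 mxE !add0r /qform mul_mx_scalar -scalemxAl mxE.
  by rewrite -eucl_sqE.
have [phiC _] := quad_C2 x 0 0 k%:M.
have [p pB pmax] : exists2 p, B p & forall y, B y -> u y - phi y <= u p - phi p.
  apply: usc_max => //; first by exists x.
  by apply: usc_onB => //; apply: continuous_lsc_on; case: phiC.
have xp := pmax _ Bx.
have phix : phi x = 0 by rewrite phiE subrr eucl_sqE mul0mx mxE mulr0.
have phip : k * `|p - x| ^+ 2 <= phi p by rewrite phiE ler_wpM2l ?norm_le_eucl// ltW.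
have phip0 : 0 <= phi p by rewrite phiE mulr_ge0 ?eucl_sq_ge0// ltW.
have pin : `|p - x| < r.
  rewrite lt_neqAle (iffLR (BE p) pB) andbT; apply/eqP => pr.
  have := SP _ pB; move: phip; rewrite pr /k mulfVK ?expf_neq0 ?gt_eqF//; lra.
have pmx : local_max (fun y => u y - phi y) p.
  have : nbhs p (ball x r).
    apply: open_nbhs_nbhs; split; first exact: ball_open.
    by rewrite -ball_normE /= distrC.
  apply: filterS => y; rewrite -ball_normE /= => yx; apply: pmax.
  by apply/BE; rewrite distrC ltW.
have [ug _] := us _ _ phiC (BO _ pB) pmx.
have := r1P p; rewrite -ball_normE /= distrC => /(_ (lt_trans pin rr1)).
rewrite ltr_distl => /andP[H1 H2]; lra.
Qed.

Lemma usc_on_maxC K u (c : R) : usc_on K u -> usc_on K (fun x => Num.max (u x) c).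
Proof.
move=> uu x Kx e e0; apply: filterS (uu _ Kx _ e0) => y uy Ky.
have H1 : u x <= Num.max (u x) c by rewrite le_max lexx.
have H2 : c <= Num.max (u x) c by rewrite le_max lexx orbT.
by rewrite gt_max; apply/andP; split; [have := uy Ky|]; lra.
Qed.

Lemma midconv_maxC (U : set V) (r : R) w u (c : R) :
  midconv U r w u -> midconv U r w (fun x => Num.max (u x) c).
Proof.
move=> uc x t /uc H.
have H1 y : u y <= Num.max (u y) c by rewrite le_max lexx.
have H2 y : c <= Num.max (u y) c by rewrite le_max lexx orbT.
have := H1 (x + t *: w); have := H1 (x - t *: w).
have := H2 (x + t *: w); have := H2 (x - t *: w).
by case: (leP (u x) c) => _; lra.
Qed.

Lemma small_factor (a b a' b' : R) : 0 <= a -> 0 <= a' -> 0 < b -> 0 < b' ->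
  exists2 d : R, 0 < d & a * d <= b /\ a' * d <= b'.
Proof.
have H (p q d : R) : 0 <= p -> 0 < q -> 0 <= d -> d <= q / (p + 1) -> p * d <= q.
  move=> p0 q0 d0; have p1 : 0 < p + 1 by lra.
  by rewrite ler_pdivlMr//; lra.
move=> a0 a'0 b0 b'0.
have d0 : 0 < Num.min (b / (a + 1)) (b' / (a' + 1)).
  by rewrite lt_min !divr_gt0//; lra.
exists (Num.min (b / (a + 1)) (b' / (a' + 1))) => //.
by split; apply: H => //; first [exact: ltW|by rewrite ge_min lexx ?orbT].
Qed.

Lemma eucl_sq_le x : `|x| <= 1 -> eucl_sq x <= n%:R.
Proof.
move=> x1; rewrite /eucl_sq -[n in n%:R]card_ord -sum1_card natr_sum.
apply: ler_sum => i _; rewrite -real_normK ?num_real// exprn_ile1//.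
apply: le_trans x1; rewrite [leRHS]mx_normrE.
exact: (le_bigmax 0 (fun ij : 'I_1 * 'I_n => `|x ij.1 ij.2|) (0, i)).
Qed.

Section Core.
Variables (Omega Dset : set V) (g u v : V -> R).
Local Notation K := (closure Omega).
Hypotheses (oO : open Omega) (O1 : forall x, Omega x -> `|x| <= 1).
Hypotheses (D0 : ~ Dset 0) (cg : continuous g).
Hypotheses (uu : usc_on K u) (lv : lsc_on K v).
Hypotheses (ug : forall x, Omega x -> u x <= g x).
Hypotheses (uc : forall w, Dset w -> midconv Omega 0 w u).
Hypotheses (vs : visc_super Dset g Omega v).
Hypotheses (uv : forall x, (K `\` Omega) x -> u x <= v x).

Lemma closure_domain_le1 x : K x -> `|x| <= 1.
Proof.
have : K `<=` closed_ball (0 : V) 1.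
  rewrite [X in _ `<=` X](closure_id _).1; last exact: closed_ball_closed.
  apply: closure_subset => y /O1 y1.
  by rewrite closed_ballE// /closed_ball_ /= sub0r normrN.
move=> KB /KB; by rewrite closed_ballE// /closed_ball_ /= sub0r normrN.
Qed.

Lemma closure_domain_compact : compact K.
Proof.
apply: (subclosed_compact (@closed_closure _ _) (@closed_ball_compact _ _ 0 1 ltr01)).
move=> x /closure_domain_le1.
by rewrite closed_ballE// /closed_ball_ /= sub0r normrN.
Qed.

(* [u - v >= m] cannot persist near the boundary, even when [u] and [v] are
   evaluated at slightly different points. *)
Lemma uniform_interior (m : R) : 0 < m -> exists2 r : R, 0 < r &
  forall x, K x ->
    (forall y, K y -> `|x - y| <= r -> m <= u y - v x ->
      forall z, `|z| <= r -> Omega (x + z)) /\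
    (forall y, `|x - y| <= r -> g y <= g x + m).
Proof.
move=> m0.
apply: (@compact_uniform_radius K (fun r x =>
    (forall y, K y -> `|x - y| <= r -> m <= u y - v x ->
      forall z, `|z| <= r -> Omega (x + z)) /\
    (forall y, `|x - y| <= r -> g y <= g x + m))); first exact: closure_domain_compact.
move=> x Kx; have m2 : 0 < m / 2 by lra.
have [r1 r10 r1P] : exists2 r : R, 0 < r & forall y, `|x - y| < r -> `|g x - g y| < m / 2.
  have /cvgrPdist_lt/(_ _ m2)/nbhs_ballP[r1 /= r10 r1P] := @cg x.
  by exists r1 => // y xy; apply: r1P; rewrite -ball_normE.
have [r2 r20 r2P] : exists2 r : R, 0 < r & forall x' y, K x' -> K y ->
    `|x - x'| < r -> `|x - y| < r -> m <= u y - v x' ->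
    forall z, `|x - z| < r -> Omega z.
  have [Ox|nOx] := pselect (Omega x).
    have /nbhs_ballP[r2 /= r20 r2P] : nbhs x Omega by exact: open_nbhs_nbhs.
    by exists r2 => // x' y _ _ _ _ _ z xz; apply: r2P; rewrite -ball_normE.
  (* At a boundary point the premise is contradictory: two losses of [m / 2] and [u x <= v x] give
     [u y - v x' < m] nearby. *)
  have /nbhs_ballP[a /= a0 aP] : \forall y \near x,
      (K y -> u y < u x + m / 2) /\ (K y -> v x - m / 2 < v y).
    by apply: filterI; [exact: uu|exact: lv].
  exists a => // x' y Kx' Ky; have := aP x'; have := aP y; rewrite -ball_normE /=.
  move=> hy hx' /hx'[_ /(_ Kx') h1] /hy[/(_ Ky) h2 _].
  have := uv (conj Kx nOx); lra.
have r12 : 0 < Num.min r1 r2 by rewrite lt_min r10 r20.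
exists (Num.min r1 r2 / 2); first lra.
move=> x' r Kx' xx' /andP[r0 rr].
have le1 : Num.min r1 r2 <= r1 by rewrite ge_min lexx.
have le2 : Num.min r1 r2 <= r2 by rewrite ge_min lexx orbT.
have tri y : `|x' - y| <= r -> `|x - y| < Num.min r1 r2.
  by move=> xy; apply: (le_lt_trans (ler_distD x' _ _)); lra.
split=> [y Ky xy muv z zr|y xy].
- apply: (r2P x' y) => //; [lra| |].
    by apply: lt_le_trans le2; exact: tri.
  by apply: lt_le_trans le2; apply: tri; rewrite opprD addNKr normrN.
- have := r1P y (lt_le_trans (tri _ xy) le1).
  have : `|g x - g x'| < m / 2 by apply: r1P; lra.
  by rewrite !ltr_distl => /andP[? ?] /andP[? ?]; lra.
Qed.

Lemma comparison_bounded (M : R) : (forall x, K x -> - M <= u x <= M) ->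
  forall x, Omega x -> u x <= v x.
Proof.
move=> uM x1 Ox1; rewrite leNgt; apply/negP => uv1.
pose m := u x1 - v x1; have m0 : 0 < m by rewrite /m; lra.
have Kx1 : K x1 by exact: subset_closure.
have K0 : K !=set0 by exists x1.
have M0 : 0 <= M by have /andP[] := uM _ Kx1; lra.
have m8 : 0 < m / 8 by lra.
have [r r0 rP] := uniform_interior m8.
(* Sup-convolution and averaging each use a quarter of the margin [r]; the remaining half is left
   for the segment [t *: w]. *)
pose rho := r / 4; have rho0 : 0 < rho by rewrite /rho; lra.
(* The part [2 * M] lets the sup-convolution inherit convexity; the extra [m] absorbs the
   approximation error [m / 8], so that a near-optimal [y0] lies within [rho] of [x0]. *)
pose L := (2 * M + m) / rho.
have Lr : L * rho = 2 * M + m by rewrite /L mulfVK// gt_eqF.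
have L0 : 0 < L by rewrite /L divr_gt0//; lra.
have n0 : 0 <= n%:R :> R by exact: ler0n.
have [d d0 [d1 d2]] : exists2 d : R, 0 < d &
    n%:R * 2 * d <= r / 4 /\ n%:R * (2 * L) * d <= m / 8.
  have n2 : 0 <= n%:R * 2 :> R by rewrite mulr_ge0.
  have n2L : 0 <= n%:R * (2 * L) by apply: mulr_ge0 => //; lra.
  have r4 : 0 < r / 4 by lra.
  exact: small_factor.
have [ep ep0 [ep1 _]] : exists2 d : R, 0 < d & n%:R * d <= m / 8 /\ n%:R * d <= m / 8.
  exact: small_factor.
pose f := supconv K u L.
have fL : lip L f by apply: (lip_supconv (M := M)) => //; exact: ltW.
pose E (i : 'I_n) : V := delta_mx 0 i.
have E1 i : `|E i| <= 1 by exact: norm_delta_le1.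
pose F := smooth E d (enum 'I_n) f.
have FC : C2 F by apply: reg2_C2; apply: reg2_smooth => //; exists L.
have Ff x : `|F x - f x| <= m / 8.
  apply: le_trans d2; have := smooth_dist d0 E1 (enum 'I_n) x fL.
  by rewrite size_enum_ord !mulrA.
have Fc w : Dset w -> midconv Omega (r / 2) w F.
  move=> Dw x t xO.
  have fc : midconv Omega rho w f.
    apply: (midconv_supconv K0 uM (ltW L0)); last exact: uc.
    - exact: subset_closure.
    - exact: ltW.
    - by rewrite Lr; lra.
  apply: (midconv_smooth d0 E1 (J := enum 'I_n) fL fc) => z.
  by rewrite size_enum_ord => zr; apply: xO; rewrite /rho in zr; lra.
pose q := quad 0 0 0 (ep%:M : 'M[R]_n).
have qE x : q x = ep * eucl_sq x.
  rewrite /q /quad subr0 mulmx0 mxE !add0r /qform mul_mx_scalar -scalemxAl mxE.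
  by rewrite -eucl_sqE.
have [qC qH] := quad_C2 0 0 0 (ep%:M : 'M[R]_n).
have [wC wH] := C2D FC qC.
have q1 x : K x -> 0 <= q x <= m / 8.
  move=> /closure_domain_le1 /eucl_sq_le xn; rewrite qE; apply/andP; split.
    by apply: mulr_ge0; [exact: ltW|exact: eucl_sq_ge0].
  by apply: le_trans ep1; rewrite mulrC ler_wpM2r// ltW.
pose h x := F x + q x.
have [x0 Kx0 x0max] : exists2 x, K x & forall y, K y -> h y - v y <= h x - v x.
  apply: usc_max => //; first exact: closure_domain_compact.
  by apply: usc_onB => //; apply: continuous_usc_on; case: wC.
have fu x : K x -> u x <= f x.
  move=> Kx; have := supconv_ge K0 uM (ltW L0) x Kx.
  by rewrite subrr normr0 mulr0 subr0.
(* From the gap [m] at [x1], three errors of [m / 8] are lost: smoothing at [x1], smoothing at [x0],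
   and the quadratic at [x0]. *)
have f0 : 5 * m / 8 <= f x0 - v x0.
  have := x0max _ Kx1; have := fu _ Kx1; rewrite /h.
  have /andP[? ?] := q1 _ Kx1; have /andP[? ?] := q1 _ Kx0.
  have := Ff x0; have := Ff x1; rewrite !ler_norml => /andP[? ?] /andP[? ?].
  have : u x1 - v x1 = m by [].
  lra.
have [y0 Ky0 y0P] := supconv_approx K0 uM (ltW L0) x0 m8.
have Lxy0 : 0 <= L * `|x0 - y0| by rewrite mulr_ge0// ltW.
rewrite -/f in y0P.
have xy0 : `|x0 - y0| <= r.
  have : L * `|x0 - y0| <= L * rho.
    rewrite Lr; have := fu _ Kx0.
    have /andP[? ?] := uM _ Kx0; have /andP[? ?] := uM _ Ky0; lra.
  by rewrite ler_pM2l// /rho; lra.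
have [Q1 Q2] := rP _ Kx0.
have x0O : forall z, `|z| <= r -> Omega (x0 + z) by apply: (Q1 y0) => //; lra.
have Ox0 : Omega x0 by have := x0O 0; rewrite normr0 addr0; apply; exact: ltW.
(* [v x0] lies more than [m / 2] below [u y0 <= g y0], while [g] changes by at most [m / 8] from
   [x0] to [y0]. This excludes the obstacle alternative for [v]. *)
have vg : v x0 < g x0.
  have Oy0 : Omega y0 by have := x0O (y0 - x0); rewrite subrKC distrC; apply.
  have := ug Oy0; have := Q2 _ xy0; lra.
have x0min : local_min (fun y => v y - h y) x0.
  have : nbhs x0 Omega by exact: open_nbhs_nbhs.
  apply: filterS => y Oy; have := x0max y (subset_closure Oy); lra.
have [|] := vs wC Ox0 x0min; first lra.
rewrite oppe_ge0 leNgt => /negP; apply.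
apply: (@lt_le_trans _ _ (2 * ep)%:E); first by rewrite lte_fin; lra.
apply: le_ereal_inf_tmp => _ [w Dw <-]; rewrite lee_fin.
have w0 : w != 0 by apply: contraPneq Dw => ->.
rewrite ler_pdivlMr ?eucl_sq_gt0// wH qH !qformD qform_tr.
have -> : qform ep%:M w = ep * eucl_sq w.
  by rewrite /qform mul_mx_scalar -scalemxAl mxE -eucl_sqE.
suff : 0 <= qform (hessian F x0) w by lra.
have w1 : 0 < `|w| + 1 by have := normr_ge0 w; lra.
apply: (@qform_hessian_ge0 _ _ F x0 w (r / 2 / (`|w| + 1))) => //.
  by rewrite divr_gt0//; lra.
move=> t /andP[t0]; rewrite ltr_pdivlMr// => tr.
apply: Fc => // z zr; apply: x0O; apply: (le_trans zr).
rewrite normrZ gtr0_norm//; lra.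
Qed.

End Core.

End Comparison.

Theorem mainTheorem2 (R : realType) (n : nat) (Omega Dset : set 'rV[R]_n)
  (g g0 u v : 'rV[R]_n -> R) :
  bounded_domain Omega -> Omega `<=` @unit_cube R n ->
  direction_set Dset ->
  continuous g ->
  continuous g0 -> D_convex Dset g0 ->
  (forall x, Omega x -> g0 x <= g x) ->
  (forall x, (@unit_cube R n `\` Omega) x -> g x = g0 x) ->
  usc_on (closure Omega) u -> lsc_on (closure Omega) v ->
  visc_sub Dset g Omega u -> visc_super Dset g Omega v ->
  (forall x, (closure Omega `\` Omega) x -> u x <= v x) ->
  forall x, Omega x -> u x <= v x.
Proof.
move=> [oO _ _ _] Ocube [_ _ D0] cg _ _ _ _ uu lv us vs uv x Ox.
have O1 y : Omega y -> `|y| <= 1.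
  move=> /Ocube y01; rewrite [leLHS]mx_normrE; apply/bigmax_leP; split=> // -[a i] _ /=.
  by rewrite (ord1 a); have /andP[? ?] := y01 i; rewrite ger0_norm.
have cK := closure_domain_compact O1.
have uN (w : 'rV[R]_n -> R) : lsc_on (closure Omega) w ->
    exists N, forall y, closure Omega y -> - N <= w y.
  move=> lw; have [|N NP] := @usc_bounded _ _ _ (fun y => 0 - w y) cK.
    by apply: usc_onB => //; apply: continuous_usc_on => y; exact: cst_continuous.
  by exists N => y /NP; lra.
have [Nv NvP] := uN _ lv; have [Ng NgP] := uN _ (continuous_lsc_on cg).
have [Nu NuP] := usc_bounded cK uu.
(* Since [- M] is below both [g] and [v] on the closure, truncating [u] at [- M] preserves the
   obstacle bound and the boundary inequality. *)
pose M := `|Nv| + `|Ng| + `|Nu|.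
have [Mv Mg Mu M0] : [/\ Nv <= M, Ng <= M, Nu <= M & 0 <= M].
  have := ler_norm Nv; have := ler_norm Ng; have := ler_norm Nu.
  have := normr_ge0 Nv; have := normr_ge0 Ng; have := normr_ge0 Nu.
  by rewrite /M; split; lra.
(* Truncation from below: [u] need not be bounded near the boundary. *)
pose u' y := Num.max (u y) (- M).
have uu' y : u y <= u' y by rewrite /u' le_max lexx.
apply: le_trans (uu' x) _.
apply: (@comparison_bounded _ _ Omega Dset g u' v oO O1 D0 cg _ lv _ _ vs _ M) => //.
- exact: usc_on_maxC.
- move=> y Oy; rewrite /u' ge_max (visc_sub_le oO cg uu us Oy) /=.
  by have := NgP _ (subset_closure Oy); lra.
- by move=> w Dw; apply: midconv_maxC; exact: (visc_sub_midconv uu us Dw D0).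
- move=> y yK; rewrite /u' ge_max uv//=; have := NvP _ yK.1; lra.
- move=> y Ky; rewrite /u' le_max lexx orbT ge_max /=.
  by apply/andP; split; [have := NuP _ Ky|]; lra.
Qed.
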